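(* Let $p$ be a prime and let $k$ be a field of characteristic $p$. Let $\Delta$ be a connected simplicial pseudomanifold of dimension $d-1$ that is oriented over $k$ and has vertex set $V=\{1,\dots,n\}$. Let $J$ be a $1\times n$ matrix of nonnegative integers with row sum $d$. Then, in $K=k(a_{i,j})_{1\le i\le d,\,1\le j\le n}$, $$\deg(x^J)=(-1)^d\sum_I \deg\big((x^I\cdot x^J)^{1/p}\big)^p\,\frac{a^I}{I!},$$ where $I$ varies over all $d\times n$ matrices of nonnegative integers whose row sums are all equal to $p-1$.
   Context: A simplicial pseudomanifold of dimension $d-1$ is a pure simplicial complex $\Delta$ of dimension $d-1$ such that every $(d-2)$-dimensional face lies in exactly two facets, and each connected component of the geometric realization of $\Delta$ remains connected after removing its $(d-3)$-skeleton. ''Oriented over $k$'' means that an orientation over $k$ is fixed: each facet $F=\{j_1<\dots<j_d\}$ is given an ordering of its vertices up to even permutation, recorded by the sign $\epsilon_F\in\{1,-1\}$ of the permutation taking $(j_1,\dots,j_d)$ to this ordering, such that $\sum_F \epsilon_F\,[j_1,\dots,j_d]$ is a simplicial cycle with coefficients in $k$. $K=k(a_{i,j})_{1\le i\le d,\,1\le j\le n}$ is the field of rational functions in the variables $a_{i,j}$; $K[\Delta]$ is the Stanley–Reisner ring of $\Delta$ over $K$ (the quotient of $K[x_1,\dots,x_n]$ by the squarefree monomials of non-faces); $\mu_i=\sum_j a_{i,j}x_j$ for $1\le i\le d$; $H(\Delta)=K[\Delta]/(\mu_1,\dots,\mu_d)$ is the generic artinian reduction, a graded ring. $H^d(\Delta)$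 is $1$-dimensional over $K$ and is spanned by the monomial $x^F=\prod_{j\in F}x_j$ of any facet $F$. The degree map $\deg\colon K[x_1,\dots,x_n]_d\to H^d(\Delta)\to K$ is the $K$-linear map, factoring through an isomorphism $H^d(\Delta)\cong K$, determined by $\deg(x^F)=\epsilon_F/[F]$ for every facet $F=\{j_1<\dots<j_d\}$, where $[F]$ is the determinant of the $d\times d$ matrix with $(i,m)$ entry $a_{i,j_m}$. For a matrix $L=(\nu_{i,j})$ of nonnegative integers with $n$ columns, $x^L=\prod_{i,j}x_j^{\nu_{i,j}}=\prod_j x_j^{\sum_i\nu_{i,j}}$. For a monomial $y$ in the $x_j$, $y^{1/p}$ denotes the monomial whose $p$th power is $y$ if it exists, and $0$ otherwise. For a $d\times n$ matrix $I=(I_{i,j})$ of nonnegative integers, $a^I=\prod_{i,j}a_{i,j}^{I_{i,j}}$ and $I!=\prod_{i,j}(I_{i,j})!$. *)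

(* Defs.v *)
From HB Require Import structures.
From mathcomp Require Import all_boot all_order all_algebra.
(* [topology] and [mpoly] cannot be imported together: their notations clash.
   The former is only imported inside the section [Realization]. *)
From mathcomp Require boolp classical_sets reals topology.
From mathcomp Require Import mpoly.

Set Implicit Arguments.
Unset Strict Implicit.
Unset Printing Implicit Defensive.

Import Order.TTheory GRing.Theory Num.Theory.
Local Open Scope ring_scope.

Section Complexes.
Variables (d n : nat).
Implicit Types (D : {set {set 'I_n}}) (F G : {set 'I_n}).

(* The vertex set is all of 'I_n, so every singleton is required to be a face. *)
Record simplicial_complex D : Prop := SimplicialComplex {
  complex_set0 : set0 \in D;
  complex_sub : forall F G, F \in D -> G \subset F -> G \in D;
  complex_vertex : forall j : 'I_n, [set j] \in D
}.

Definition facets D : {set {set 'I_n}} :=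
  [set F | maxset [pred G in D] F].

(* A face of dimension e has e + 1 vertices. *)
Definition pure_of_dim D := forall F, F \in facets D -> #|F| = d.

Definition ridges_in_two_facets D := forall G, G \in D -> #|G|.+1 = d ->
  #|[set F in facets D | G \subset F]| = 2.

End Complexes.

Section Realization.
Import boolp classical_sets reals topology numFieldTopology.Exports.
Local Open Scope classical_set_scope.
Variables (R : realType) (n : nat).
Implicit Type (D : {set {set 'I_n}}).

Definition carrier (x : 'rV[R]_n) : {set 'I_n} :=
  finset (fun j : 'I_n => x 0 j != 0).

Definition realization D : set 'rV[R]_n :=
  [set x : 'rV[R]_n |
    [/\ forall j, 0 <= x 0 j, \sum_j x 0 j = 1 & carrier x \in D]].

Definition connected_complex D : Prop := connected (realization D).

(* The realization of the (d - 3)-skeleton, whose faces have at most d - 2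
   vertices; it is empty if d <= 2. *)
Definition codim2_skeleton D (d : nat) : set 'rV[R]_n :=
  [set x : 'rV[R]_n | realization D x /\ (#|carrier x|.+2 <= d)%N].

Definition components_stay_connected D (d : nat) : Prop :=
  forall x, realization D x ->
    connected (connected_component (realization D) x `\` codim2_skeleton D d).

End Realization.

(* Simplicial pseudomanifolds of dimension d - 1 on the vertex set 'I_n. *)
Record pseudomanifold (R : reals.Real.type) (d n : nat)
    (D : {set {set 'I_n}}) : Prop := Pseudomanifold {
  pm_complex : simplicial_complex D;
  pm_pure : pure_of_dim d D;
  pm_ridge : ridges_in_two_facets d D;
  pm_strong : components_stay_connected R D d
}.

Section Orientation.
Variables (k : fieldType) (n : nat).

(* A chain assigns to every G = {j_1 < ... < j_m} the coefficient of
   [j_1, ..., j_m].  Removing v from v |: G contributes (-1)^(rank of v). *)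
Definition boundary (c : {set 'I_n} -> k) (G : {set 'I_n}) : k :=
  \sum_(v | v \notin G) (-1) ^+ #|[set u in G | (u < v)%N]| * c (v |: G).

(* The sign epsilon_F is (-1) ^+ eps F; the values of eps at sets which are
   not facets are irrelevant. *)
Definition orientation_chain (D : {set {set 'I_n}}) (eps : {set 'I_n} -> bool)
    (F : {set 'I_n}) : k :=
  if F \in facets D then (-1) ^+ eps F else 0.

Definition orientation D (eps : {set 'I_n} -> bool) : Prop :=
  forall G, boundary (orientation_chain D eps) G = 0.

End Orientation.

Notation ratfun k d n := {fraction {mpoly k[(d * n)%N]}}.

Section DegreeMap.
Variables (k : fieldType) (d n : nat).
Local Notation K := (ratfun k d n).
Local Notation S := {mpoly K[n]}.
Implicit Type (D : {set {set 'I_n}}).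

Definition a_ (i : 'I_d) (j : 'I_n) : K :=
  tofrac ('X_(mxvec_index i j) : {mpoly k[(d * n)%N]}).

Definition mu (i : 'I_d) : S := \sum_j a_ i j *: 'X_j.

Definition xset (F : {set 'I_n}) : S := \prod_(j in F) 'X_j.

(* The kernel of the quotient map from S to
   H(D) = K[D] / (mu_1, ..., mu_d). *)
Definition artinian_ideal D (f : S) : Prop :=
  exists (g : {set 'I_n} -> S) (h : 'I_d -> S),
    f = \sum_(G | G \notin D) g G * xset G + \sum_i h i * mu i.

(* The determinant [F], for #|F| = d; [enum F] is increasing. *)
Definition bracket (F : {set 'I_n}) : K :=
  \det (\matrix_(i < d, m < d) nth 0 [seq a_ i j | j <- enum F] m).

(* The degree map is only relevant on the homogeneous polynomials of degree d;
   as a matter of convenience it is represented by an arbitrary linear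
   extension to S.  That it factors through an isomorphism from H^d(D) to K
   means that its kernel in degree d is the ideal; it is onto since it does not
   vanish at facets. *)
Record degree_map D (eps : {set 'I_n} -> bool) (deg : {scalar S}) : Prop :=
  DegreeMap {
    degree_ker : forall f : S, f \is d.-homog ->
      (deg f = 0 <-> artinian_ideal D f);
    degree_facet : forall F, F \in facets D ->
      deg (xset F) = (-1) ^+ eps F / bracket F
  }.

Definition a_exp (I : 'M[nat]_(d, n)) : K := \prod_i \prod_j a_ i j ^+ I i j.

End DegreeMap.

Definition mx_fact (d n : nat) (I : 'M[nat]_(d, n)) : nat :=
  (\prod_i \prod_j (I i j)`!)%N.

(* The exponent of x^L. *)
Definition mnm_of_mx (r n : nat) (L : 'M[nat]_(r, n)) : 'X_{1..n} :=
  [multinom (\sum_i L i j)%N | j < n].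

(* (x^m)^(1/p): the only candidate root has exponents m j %/ p. *)
Definition proot (A : nzRingType) (p n : nat) (m : 'X_{1..n}) : {mpoly A[n]} :=
  let q := [multinom (m j %/ p)%N | j < n] in
  if (q *+ p)%MM == m then 'X_[q] else 0.

(* The d x n matrices of natural numbers whose row sums are all p - 1; their
   entries are less than p, so that they range over a finite type. *)
Definition row_sums_pm1 (p d n : nat) (I : 'M['I_p]_(d, n)) : bool :=
  [forall i, (\sum_j (I i j : nat))%N == p.-1].

Definition nat_mx (p d n : nat) (I : 'M['I_p]_(d, n)) : 'M[nat]_(d, n) :=
  map_mx (@nat_of_ord p) I.

(* Main.v *)
From HB Require Import structures.
Require Import Defs.
From mathcomp Require Import all_boot all_order all_algebra perm.
From mathcomp Require Import reals ring.
From mathcomp.multinomials Require Import ssrcomplements mpoly.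

Set Implicit Arguments.
Unset Strict Implicit.
Unset Printing Implicit Defensive.

Import GRing.Theory.
Local Open Scope ring_scope.

(** Write P for the product of the powers mu_i^(p-1).  The proof rests on one
    K-linear functional theta on K[x_1, ..., x_n], which sends a monomial m of
    degree d p to deg (m^(1/p))^p and every other monomial to 0.

    The right-hand side of the formula is theta (x^J P).  Indeed, by the
    multinomial theorem for divided powers, mu_i^(p-1) / (p-1)! is the sum of
    the a^I/I! x^I over the row vectors I of sum p-1, and (p-1)! = -1 in k by
    Wilson's theorem; multiplying over the d rows gives P up to the sign (-1)^d
    ([mu_power_expand]).

    The functional f |-> theta (f P) kills the ideal of H(D)
    ([theta_ideal]).  It kills multiples of x^G for a non-face G, because the
    p-th root of a multiple of x^G is again a multiple of x^G.  It kills
    multiples of mu_i, because mu_i P contains the factor mu_i^p, which by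
    Frobenius is the sum of the a_ij^p x_j^p, so that theta (m mu_i^p) is the
    p-th power of deg (m^(1/p) mu_i) = 0.

    The kernel of deg on forms of degree d is exactly that ideal, and deg is
    not zero at a facet F, so it only remains to compare the two functionals at
    x^F.  The only monomial m of P for which x^F m contributes to
    theta (x^F P) is m = (x^F)^(p-1), with root x^F.  The coefficient of that
    monomial in P is [F]^(p-1) ([mcoeff_mu_power]), whence
    theta (x^F P) = [F]^(p-1) (eps_F/[F])^p = eps_F/[F] = deg x^F. *)

(** * Linear functionals given by their values on monomials *)

Section MonomialFunctional.
Variables (A : comNzRingType) (n : nat) (w : 'X_{1..n} -> A).

Definition mlin (f : {mpoly A[n]}) : A := \sum_(m <- msupp f) f@_m * w m.

(** Over a common bound on the degrees, linearity can be read off termwise. *)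
Lemma mlinwE b f : (msize f <= b)%N ->
  mlin f = \sum_(m : 'X_{1..n < b}) f@_m * w m.
Proof.
move=> le_fb; rewrite /mlin (big_mksub 'X_{1..n < b}) /=; first last.
- by move=> m /msize_mdeg_lt /leq_trans; apply.
- exact: msupp_uniq.
rewrite big_rmcond //= => m /memN_msupp_eq0 ->; exact: mul0r.
Qed.

Lemma mlin_is_scalar : scalar mlin.
Proof.
move=> c f g; pose b := maxn (maxn (msize f) (msize g)) (msize (c *: f + g)).
rewrite !(@mlinwE b) ?leq_max ?leqnn ?orbT // mulr_sumr -big_split /=.
by apply: eq_bigr => m _; rewrite mcoeffD mcoeffZ mulrDl mulrA.
Qed.

HB.instance Definition _ := GRing.isLinear.Build A {mpoly A[n]} A _ mlin
  mlin_is_scalar.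

Lemma mlinX m : mlin 'X_[m] = w m.
Proof. by rewrite /mlin msuppX big_seq1 mcoeffX eqxx mul1r. Qed.

Lemma mlin_mul f g :
  mlin (f * g) = \sum_(m <- msupp f) f@_m * mlin ('X_[m] * g).
Proof.
rewrite {1}[f]mpolyE mulr_suml linear_sum /=; apply: eq_bigr => m _.
by rewrite -scalerAl linearZ.
Qed.

Lemma mlin_mulX_single u q f : (forall m, m != q -> w (u + m)%MM = 0) ->
  mlin ('X_[u] * f) = f@_q * w (u + q)%MM.
Proof.
move=> w0; rewrite mulrC mlin_mul.
under eq_bigr => m _ do rewrite -mpolyXD mlinX addmC.
have [qf|qf] := boolP (q \in msupp f).
  rewrite (bigD1_seq q) //= ?msupp_uniq // big1 ?addr0 // => m /w0 ->.
  exact: mulr0.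
rewrite (memN_msupp_eq0 qf) mul0r big1_seq // => m /andP[_ mf].
by rewrite w0 ?mulr0 //; apply: contraNneq qf => <-.
Qed.

End MonomialFunctional.

(** * The multinomial theorem for divided powers *)

Section DividedPowers.
Variables (F : fieldType) (A : comAlgType F) (N : nat).
Hypothesis fact_unit : forall m, (m < N)%N -> m`!%:R != 0 :> F.

(** The exponential series in [y * 'X], truncated where the factorials may
    vanish. *)
Let E (y : A) : {poly A} := \poly_(m < N) ((m`!%:R)^-1 *: y ^+ m).

(** Truncation does not disturb the coefficients below [N], so that there the
    product of exponentials is the exponential of the sum. *)
Lemma coef_prod_exp n (y : 'I_n -> A) m : (m < N)%N ->
  (\prod_j E (y j))`_m = (m`!%:R)^-1 *: (\sum_j y j) ^+ m.
Proof.
elim: n y m => [|n IHn] y m lt_mN.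
  rewrite !big_ord0 coef1; case: m lt_mN => [|m] _.
    by rewrite fact0 invr1 scale1r expr0.
  by rewrite expr0n /= scaler0.
rewrite !big_ord_recl coefM [_ + _]addrC exprDn scaler_sumr.
apply: eq_bigr => -[i /=]; rewrite ltnS => le_im _.
rewrite coef_poly (leq_ltn_trans le_im) // IHn ?(leq_ltn_trans (leq_subr _ _))
  //.
rewrite -scalerAl -scalerAr scalerA [X in _ = _ *: (X *+ _)]mulrC.
rewrite -scaler_nat scalerA; congr (_ *: _).
have [fi fmi] : i`!%:R != 0 :> F /\ (m - i)`!%:R != 0 :> F.
  split; apply: fact_unit; first exact: leq_ltn_trans lt_mN.
  by rewrite (leq_ltn_trans (leq_subr _ _)).
have := fact_unit lt_mN; rewrite -(bin_fact le_im) !natrM => fm.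
have binmi : 'C(m, i)%:R != 0 :> F by apply: contraNneq fm => ->; rewrite mul0r.
by field; rewrite fi fmi binmi.
Qed.

(** Both sides are the coefficient of ['X^m] in the product of the truncated
    exponentials of the [y j], expanded by distributivity on the right. *)
Lemma multinomial_divided n (y : 'I_n -> A) m : (m < N)%N ->
  (m`!%:R)^-1 *: (\sum_j y j) ^+ m =
  \sum_(f : {ffun 'I_n -> 'I_N} | (\sum_j f j)%N == m)
     \prod_j (((f j)`!%:R)^-1 *: y j ^+ f j).
Proof.
move=> lt_mN; rewrite -coef_prod_exp //.
under eq_bigr => j _.
  rewrite /E poly_def; under eq_bigr => i _ do rewrite -mul_polyC.
  over.
rewrite bigA_distr_bigA coef_sum [RHS]big_mkcond; apply: eq_bigr => f _ /=.
rewrite big_split -(rmorph_prod (@polyC A)) /= prodrXr coefCM coefXn eq_sym.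
by case: eqP; rewrite ?mulr1 ?mulr0.
Qed.

End DividedPowers.

(** * Products of (p-1)-st powers of linear forms modulo p-th powers *)

(** An ideal is represented by an arbitrary closed predicate, since only
    congruences modulo the ideal matter and no quotient ring is formed. *)
Section Ideal.
Variable A : comNzRingType.
Variable I : A -> Prop.
Hypotheses (I0 : I 0) (ID : forall a b, I a -> I b -> I (a + b))
  (IM : forall a b, I b -> I (a * b)).

Lemma ideal_sum (T : Type) (r : seq T) (P : pred T) (a : T -> A) :
  (forall i, P i -> I (a i)) -> I (\sum_(i <- r | P i) a i).
Proof. by move=> Ia; elim/big_ind: _. Qed.

Lemma ideal_prod_congr (T : Type) (r : seq T) (P : pred T) (a b : T -> A) :
  (forall i, P i -> I (a i - b i)) ->
  I (\prod_(i <- r | P i) a i - \prod_(i <- r | P i) b i).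
Proof.
move=> Iab; apply: (big_ind2 (fun x y => I (x - y))) => //.
  by rewrite subrr.
move=> x1 x2 y1 y2 Ix Iy.
have -> : x1 * y1 - x2 * y2 = x1 * (y1 - y2) + y2 * (x1 - x2).
  by rewrite !mulrBr addrA [y2 * x1]mulrC subrK [y2 * _]mulrC.
by apply: ID; apply: IM.
Qed.

End Ideal.

Section FrobeniusPower.
Variables (p : nat) (F : fieldType) (A : comAlgType F).
Hypothesis pF : p \in [pchar F].

Lemma pchar_alg : p \in [pchar A].
Proof. exact: (rmorph_pchar (in_alg A)). Qed.

Lemma pFrobenius_sum (I : Type) (r : seq I) (P : pred I) (c : I -> F)
    (y : I -> A) :
  (\sum_(i <- r | P i) c i *: y i) ^+ p =
  \sum_(i <- r | P i) c i ^+ p *: y i ^+ p.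
Proof.
rewrite -(pFrobenius_autE pchar_alg) rmorph_sum /=; apply: eq_bigr => i _.
exact: exprZn.
Qed.

(** This is what makes the (p-1)-st power of a determinant insensitive to the
    order of the rows; it holds for [p = 2] as well. *)
Lemma pchar_signX : (-1) ^+ p.-1 = 1 :> F.
Proof.
have p_gt0 : (0 < p)%N := prime_gt0 (pcharf_prime pF).
have: (-1) ^+ p = -1 :> F by exact: (rmorphN1 (pFrobenius_aut pF)).
rewrite -{1}(prednK p_gt0) exprSr mulrN1 => /eqP.
by rewrite eqr_opp => /eqP.
Qed.

Lemma pchar_Wilson : (p.-1)`!%:R = -1 :> F.
Proof.
have pr_p := pcharf_prime pF.
have: (p %| (p.-1)`!.+1)%N by rewrite -Wilson ?prime_gt1.
rewrite (dvdn_pcharf pF) -natr1 addr_eq0 => /eqP //.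
Qed.

Lemma pchar_fact_neq0 m : (m < p)%N -> m`!%:R != 0 :> F.
Proof.
move=> lt_mp; rewrite -(dvdn_pcharf pF) fact_prod.
rewrite Euclid_dvd_prod ?(pcharf_prime pF) // big_has; apply/hasPn => i.
rewrite mem_index_iota ltnS => /andP[i_gt0 le_im].
by rewrite gtnNdvd // (leq_ltn_trans le_im).
Qed.

Variable I : A -> Prop.
Hypotheses (I0 : I 0) (ID : forall a b, I a -> I b -> I (a + b))
  (IM : forall a b, I b -> I (a * b)).

Lemma idealZ c a : I a -> I (c *: a).
Proof. by move=> Ia; rewrite -mulr_algl; apply: IM. Qed.

(** The case of a triangular matrix, with respect to the order of the indices by
    [r]: multiplied by the (p-1)-st powers of the earlier forms, the i-th form
    can be replaced with its diagonal term, since each [y l] that it drops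
    completes a p-th power. *)
Lemma triangular_prod d (r : 'I_d -> nat) (r_inj : injective r) (M : 'M[F]_d)
    (y : 'I_d -> A) :
  (forall i j, (r i < r j)%N -> M i j = 0) -> (forall j, I (y j ^+ p)) ->
  I (\prod_i (\sum_j M i j *: y j) ^+ p.-1 -
     (\prod_i M i i) ^+ p.-1 *: \prod_i y i ^+ p.-1).
Proof.
move=> M0 Iy; pose z i := \sum_j M i j *: y j.
have p_gt0 : (0 < p)%N := prime_gt0 (pcharf_prime pF).
have step b : I (\prod_(i | (r i < b)%N) z i ^+ p.-1 -
                 \prod_(i | (r i < b)%N) (M i i *: y i) ^+ p.-1).
  elim: b => [|b IHb]; first by rewrite !big_pred0 // subrr.
  have [/existsP[i0 /eqP ri0]|/existsPn nob] := boolP [exists i, r i == b];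
    last first.
    rewrite (eq_bigl (fun i => r i < b)%N); last first.
      by move=> i; rewrite ltnS leq_eqVlt (negPf (nob i)).
    rewrite [X in I (_ - X)](eq_bigl (fun i => r i < b)%N) //.
    by move=> i; rewrite ltnS leq_eqVlt (negPf (nob i)).
  have lt_b i : (r i < b.+1)%N && (i != i0) = (r i < b)%N.
    by rewrite -(inj_eq r_inj) ri0 ltnS [in RHS]ltn_neqAle andbC.
  rewrite !(bigD1 i0 (P := fun i => (r i < b.+1)%N)) ?ri0 //=.
  rewrite !(eq_bigl _ _ lt_b).
  set Z := \prod_(i | _) _ in IHb *; set Y := \prod_(i | _) _ in IHb *.
  set u := M i0 i0 *: y i0.
  have -> : z i0 ^+ p.-1 * Z - u ^+ p.-1 * Y =
      z i0 ^+ p.-1 * (Z - Y) + (z i0 ^+ p.-1 - u ^+ p.-1) * Y.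
    by rewrite mulrBr mulrBl addrA subrK.
  apply: ID; first exact: IM.
  rewrite subrXX mulrAC mulrC; apply: IM.
  rewrite /z (bigD1 i0) //= -/u addrC addrK mulr_suml.
  apply: (ideal_sum I0 ID) => l l_i0; rewrite -scalerAl.
  have [lt_lb|] := ltnP (r l) b; last first.
    rewrite leq_eqVlt -ri0 (inj_eq r_inj) eq_sym (negPf l_i0) => /M0 ->.
    by rewrite scale0r.
  apply: idealZ; rewrite /Y (bigD1 l) //= exprZn mulrA -scalerAr -exprS.
  by rewrite prednK // mulrC; apply/IM/idealZ.
have [b lt_rb] : exists b, forall i, (r i < b)%N.
  by exists (\max_i r i).+1 => i; rewrite ltnS leq_bigmax.
have all_b : (fun i => (r i < b)%N) =1 xpredT by move=> i; rewrite lt_rb.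
have := step b; rewrite !(eq_bigl _ _ all_b).
under [X in I (_ - X) -> _]eq_bigr => i _ do rewrite exprZn.
by rewrite scaler_prod !prodrXl.
Qed.

(** For variables [y j], the product of the [y j ^+ p.-1] spans the socle of the
    polynomial ring modulo the ideal of the [y j ^+ p]; this ideal is invariant
    under linear substitutions, which therefore act on the socle by a character
    of the linear group, namely the (p-1)-st power of the determinant.  The LUP
    decomposition reduces the claim to two triangular substitutions; the p-th
    powers of the intermediate forms [u i] lie in the ideal by Frobenius. *)
Lemma det_prod d (M : 'M[F]_d) (y : 'I_d -> A) : (forall j, I (y j ^+ p)) ->
  I (\prod_i (\sum_j M i j *: y j) ^+ p.-1 -
     (\det M) ^+ p.-1 *: \prod_i y i ^+ p.-1).
Proof.
case: d M y => [|d] M y Iy.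
  by rewrite !big_ord0 det_mx00 expr1n scale1r subrr.
move: (cormen_lup_perm M) (cormen_lup_correct M) (cormen_lup_detL M).
move: (@cormen_lup_lower _ _ M) (@cormen_lup_upper _ _ M).
case: (cormen_lup M) => [[P L] U] /= Llow Uup /is_perm_mxP[s ->] PM detL.
pose u i := \sum_j U i j *: y j.
have Iu i : I (u i ^+ p).
  by rewrite pFrobenius_sum; apply: (ideal_sum I0 ID) => j _; apply: idealZ.
have -> : \prod_i (\sum_j M i j *: y j) ^+ p.-1 =
          \prod_i (\sum_j L i j *: u j) ^+ p.-1.
  rewrite (reindex_inj (@perm_inj _ s)) /=; apply: eq_bigr => i _.
  congr (_ ^+ _).
  under [RHS]eq_bigr => j _ do rewrite scaler_sumr.
  rewrite exchange_big /=; apply: eq_bigr => l _.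
  under eq_bigr => j _ do rewrite scalerA.
  rewrite -scaler_suml; congr (_ *: _).
  by have /matrixP/(_ i l) := PM; rewrite -mulmxE -row_permE !mxE.
have detU : (\det M) ^+ p.-1 = (\prod_i U i i) ^+ p.-1.
  have /(congr1 determinant) := PM; rewrite !det_mulmx det_perm detL mul1r.
  move/(congr1 (fun c => c ^+ p.-1)).
  rewrite exprMn -exprM mulnC exprM pchar_signX expr1n mul1r => ->.
  rewrite -det_tr det_trig; last first.
    by apply/is_trig_mxP => i j lt_ij; rewrite mxE Uup.
  by congr (_ ^+ _); apply: eq_bigr => i _; rewrite mxE.
have IL : I (\prod_i (\sum_j L i j *: u j) ^+ p.-1 - \prod_i u i ^+ p.-1).
  have := triangular_prod val_inj (M := L) _ Iu.
  rewrite [\prod_i L i i]big1 => [|i _]; last by rewrite Llow ?eqxx.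
  rewrite expr1n scale1r; apply=> i j lt_ij.
  by rewrite Llow ?(ltnW lt_ij) // -val_eqE (ltn_eqF lt_ij).
have IU := triangular_prod (r := fun i => rev_ord i)
  (inj_comp val_inj rev_ord_inj) (M := U) _ Iy.
rewrite detU -[X in I (X - _)](subrK (\prod_i u i ^+ p.-1)) -addrA.
apply: ID => //; apply: IU => i j /=; rewrite !subSS => lt_ij; apply: Uup.
by rewrite -(ltn_sub2lE _ (leq_ord i)).
Qed.

End FrobeniusPower.

(** * Roots of monomials *)

Section Proot.
Variables (A : nzRingType) (p n : nat).
Hypothesis p_gt0 : (0 < p)%N.
Implicit Type m : 'X_{1..n}.

Lemma proot_muln m : proot A p (m *+ p)%MM = 'X_[m].
Proof.
rewrite /proot; have -> : [multinom ((m *+ p)%MM j %/ p)%N | j < n] = m.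
  by apply/mnmP => j; rewrite mnmE mulmnE mulnK.
by rewrite eqxx.
Qed.

Lemma prootP m :
  (exists q, m = (q *+ p)%MM) \/
  (forall q, m <> (q *+ p)%MM) /\ proot A p m = 0.
Proof.
rewrite /proot; case: eqP => [<-|nm]; first by left; eexists.
right; split=> // q mq; case: nm; rewrite mq; congr (_ *+ _)%MM.
by apply/mnmP => j; rewrite mnmE mulmnE mulnK.
Qed.

End Proot.

(** * The determinants of the facets *)

Section Bracket.
Variables (k : fieldType) (d n : nat).
Local Notation K := (ratfun k d n).

Lemma det_generic_neq0 (f : 'I_d -> 'I_n) : injective f ->
  \det (\matrix_(i < d, m < d) a_ k i (f m)) != 0.
Proof.
move=> f_inj.
pose X : 'M[{mpoly k[(d * n)%N]}]_d :=
  \matrix_(i < d, m < d) 'X_(mxvec_index i (f m)).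
have -> : \matrix_(i < d, m < d) a_ k i (f m) = map_mx (@tofrac _) X.
  by apply/matrixP => i m; rewrite !mxE.
rewrite det_map_mx tofrac_eq0.
(* Specialize the variables so that the matrix becomes the identity. *)
pose v := mxvec (\matrix_(i < d, j < n) ((j == f i)%:R : k)).
have: (\det X).@[fun t => v 0 t] = 1.
  rewrite -det_map_mx -[RHS](det1 _ d); congr determinant.
  apply/matrixP => i m.
  by rewrite !mxE [LHS]mevalXU mxvecE mxE (inj_eq f_inj) eq_sym.
by apply: contra_eq_neq => ->; rewrite meval0 eq_sym oner_eq0.
Qed.

Variables (F : {set 'I_n}) (cardF : #|F| = d).

Definition vertex (m : 'I_d) : 'I_n := enum_val (cast_ord (esym cardF) m).

Lemma vertex_inj : injective vertex.
Proof. by move=> m1 m2 /enum_val_inj /cast_ord_inj. Qed.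

Lemma big_vertex (T : Type) (idx : T) (op : Monoid.com_law idx)
    (G : 'I_n -> T) :
  \big[op/idx]_(j in F) G j = \big[op/idx]_(m < d) G (vertex m).
Proof.
rewrite big_enum_val; apply: (reindex (cast_ord (esym cardF))).
by apply: onW_bij; exists (cast_ord cardF) => ?; rewrite ?cast_ordK ?cast_ordKV.
Qed.

Lemma bracketE : bracket k d F = \det (\matrix_(i, m) a_ k i (vertex m)).
Proof.
congr determinant; apply/matrixP => i m; rewrite !mxE.
rewrite (nth_map (vertex m)) -?cardE ?cardF //.
by rewrite [in RHS]/vertex (enum_val_nth (vertex m)).
Qed.

Lemma bracket_neq0 : bracket k d F != 0.
Proof. rewrite bracketE; exact/det_generic_neq0/vertex_inj. Qed.

End Bracket.

(** * The functional theta and its comparison with the degree map *)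

Definition mnm_ind n (F : {set 'I_n}) : 'X_{1..n} :=
  [multinom (j \in F : nat) | j < n].

Lemma mdeg_ind n (F : {set 'I_n}) : mdeg (mnm_ind F) = #|F|.
Proof.
rewrite mdegE -sum1_card [RHS]big_mkcond; apply: eq_bigr => j _ /=.
by rewrite mnmE; case: ifP.
Qed.

Section DegreeFormula.
Variables (p : nat) (k : fieldType) (d n : nat).
Hypothesis hp : p \in [pchar k].
Local Notation K := (ratfun k d n).
Local Notation S := {mpoly K[n]}.

Let p_gt0 : (0 < p)%N := prime_gt0 (pcharf_prime hp).

Lemma pchar_ratfun : p \in [pchar K].
Proof.
exact: (rmorph_pchar (@tofrac _ \o @mpolyC (d * n) k : {rmorphism k -> K})).
Qed.

Lemma xsetE (F : {set 'I_n}) : xset k d F = 'X_[mnm_ind F].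
Proof.
rewrite [RHS]mpolyXE_id /xset big_mkcond; apply: eq_bigr => j _.
by rewrite mnmE; case: ifP.
Qed.

Definition mu_power : S := \prod_i mu k n i ^+ p.-1.

(** Only the divisors of the monomial matter for its coefficient, so one can
    compute modulo the ideal of the polynomials in which no such divisor occurs.
    It contains [x_j] for [j] outside [F] and [x_j ^+ p] for [j] in [F], and
    [det_prod] applies. *)
Lemma mcoeff_mu_power (F : {set 'I_n}) : #|F| = d ->
  mu_power@_(mnm_ind F *+ p.-1)%MM = bracket k d F ^+ p.-1.
Proof.
move=> cardF; set q := (_ *+ _)%MM.
pose I (f : S) : Prop := forall m, (m <= q)%MM -> f@_m = 0.
have I0 : I 0 by move=> m _; rewrite mcoeff0.
have ID a b : I a -> I b -> I (a + b).
  by move=> Ia Ib m le_mq; rewrite mcoeffD Ia ?Ib ?addr0.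
have IM a b : I b -> I (a * b).
  move=> Ib m le_mq; rewrite mcoeffM big1 // => -[m1 m2] /= /eqP mE.
  rewrite [b@_ _]Ib ?mulr0 //; apply: lepm_trans le_mq.
  by have := lem_addl m1 m2; rewrite -mE.
have IX (j : 'I_n) e : (q j < e)%N -> I ('X_j ^+ e).
  move=> lt_qe m /mnm_lepP/(_ j); rewrite mcoeffXn; case: eqP => // <-.
  by rewrite mulmnE mnm1E eqxx mul1n leqNgt lt_qe.
have qE j : q j = ((j \in F) * p.-1)%N by rewrite mulmnE mnmE.
pose y (m : 'I_d) : S := 'X_(vertex cardF m).
have Iy m : I (y m ^+ p).
  by apply: IX; rewrite qE enum_valP mul1n prednK.
have Idet := det_prod pchar_ratfun I0 ID IM
  (\matrix_(i, m) a_ k i (vertex cardF m)) Iy.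
have Imu : I (mu_power -
    \prod_i (\sum_m (\matrix_(i, m) a_ k i (vertex cardF m)) i m *: y m)
      ^+ p.-1).
  apply: (ideal_prod_congr I0 ID IM) => /= i _.
  rewrite subrXX mulrC; apply: (IM).
  rewrite /mu (bigID (mem F)) /= (big_vertex cardF) addrAC.
  under [X in _ - X]eq_bigr => m _ do rewrite mxE.
  rewrite subrr add0r; apply: (ideal_sum I0 ID) => // j jF.
  apply: (@idealZ K _ _ IM).
  by rewrite -['X_j]expr1; apply: IX; rewrite qE (negPf jF).
have := ID _ _ Imu Idet; rewrite addrA subrK -bracketE.
move=> /(_ q (lepm_refl _)); rewrite mcoeffB mcoeffZ => /eqP.
rewrite subr_eq0 => /eqP ->; rewrite prodrXl.
have -> : \prod_m y m = xset k d F by rewrite /xset (big_vertex cardF).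
by rewrite xsetE mpolyXn mcoeffX eqxx mulr1.
Qed.

(** The sign is the product over the rows of (p-1)! = -1, by which
    [mu_i ^+ p.-1] differs from a divided power. *)
Lemma mu_power_expand :
  mu_power = (-1) ^+ d *: \sum_(I : 'M['I_p]_(d, n) | row_sums_pm1 I)
    (a_exp k (nat_mx I) / (mx_fact (nat_mx I))%:R) *: 'X_[mnm_of_mx (nat_mx I)].
Proof.
have pK := pchar_ratfun.
have row (i : 'I_d) : mu k n i ^+ p.-1 = - 1 *:
    \sum_(f : {ffun 'I_n -> 'I_p} | (\sum_j f j)%N == p.-1)
      \prod_j (((f j)`!%:R)^-1 *: (a_ k i j *: 'X_j) ^+ f j).
  rewrite -(multinomial_divided (@pchar_fact_neq0 _ _ pK)) ?ltn_predL //.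
  by rewrite pchar_Wilson // scalerA invrN1 mulrNN mulr1 scale1r.
rewrite /mu_power; under eq_bigr => i _ do rewrite row.
rewrite scaler_prod prodr_const card_ord; congr (_ *: _).
rewrite bigA_distr_big /=.
pose toM (h : {ffun 'I_d -> {ffun 'I_n -> 'I_p}}) : 'M['I_p]_(d, n) :=
  \matrix_(i, j) h i j.
rewrite (reindex toM) /=; last first.
  exists (fun I : 'M['I_p]_(d, n) => [ffun i => [ffun j => I i j]]) => [h|I] _.
    by apply/ffunP => i; apply/ffunP => j; rewrite !ffunE mxE.
  by apply/matrixP => i j; rewrite mxE !ffunE.
apply: eq_big => [h|h _].
  apply/ffun_onP/forallP => hE i; have := hE i; rewrite ?inE;
  by under eq_bigr => j _ do rewrite mxE.
under eq_bigr => i _ do under eq_bigr => j _ do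
  rewrite exprZn scalerA.
under eq_bigr => i _ do rewrite scaler_prod.
rewrite scaler_prod; congr (_ *: _).
  rewrite /a_exp /mx_fact natr_prod -prodfV -big_split; apply: eq_bigr => i _.
  rewrite natr_prod -prodfV -big_split; apply: eq_bigr => j _ /=.
  by rewrite !mxE mulrC.
rewrite [RHS]mpolyXE_id exchange_big; apply: eq_bigr => j _.
by rewrite mnmE prodrXr; under [in RHS]eq_bigr => i _ do rewrite !mxE.
Qed.

Variable deg : {scalar S}.

(** The degree test keeps [deg] away from the polynomials which are not
    homogeneous of degree [d], where its values are arbitrary. *)
Definition root_weight (m : 'X_{1..n}) : K :=
  if mdeg m == (d * p)%N then deg (proot K p m) ^+ p else 0.

Lemma root_weight_muln u : root_weight (u *+ p)%MM =
  if mdeg u == d then deg 'X_[u] ^+ p else 0.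
Proof. by rewrite /root_weight mdegMn eqn_pmul2r // proot_muln. Qed.

Lemma root_weightP m :
  (exists2 u, m = (u *+ p)%MM & mdeg u = d) \/ root_weight m = 0.
Proof.
have [[u ->]|[_ rm0]] := prootP K p_gt0 m.
  rewrite root_weight_muln; case: eqP => [du|_]; last by right.
  by left; exists u.
right; rewrite /root_weight rm0 linear0 expr0n.
by rewrite (negPf (lt0n_neq0 p_gt0)) if_same.
Qed.

Local Notation theta := (mlin root_weight).

Variable D : {set {set 'I_n}}.
Hypothesis deg_ideal : forall f : S, f \is d.-homog -> artinian_ideal D f ->
  deg f = 0.

Lemma deg_nonface G u : G \notin D -> mdeg u = d -> (mnm_ind G <= u)%MM ->
  deg 'X_[u] = 0.
Proof.
move=> GD du le_Gu; apply: deg_ideal; first by rewrite dhomogX; apply/eqP.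
exists (fun G' => if G' == G then 'X_[u - mnm_ind G] else 0), (fun=> 0).
rewrite [X in _ + X]big1 => [|i _]; last by rewrite mul0r.
rewrite addr0 (bigD1 G) //= eqxx xsetE -mpolyXD submK // big1 ?addr0 //.
by move=> G' /andP[_ /negPf->]; rewrite mul0r.
Qed.

Lemma deg_mulX_mu (i : 'I_d) u : (mdeg u).+1 = d ->
  \sum_j a_ k i j * deg 'X_[u + U_(j)] = 0.
Proof.
move=> du; have muE : 'X_[u] * mu k n i = \sum_j a_ k i j *: 'X_[u + U_(j)].
  by rewrite mulr_sumr; apply: eq_bigr => j _; rewrite -scalerAr mpolyXD.
transitivity (deg ('X_[u] * mu k n i)).
  by rewrite muE linear_sum /=; apply: eq_bigr => j _; rewrite linearZ.
apply: deg_ideal.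
  rewrite muE; apply: rpred_sum => j _; apply: rpredZ.
  by rewrite dhomogX /= mdegD mdeg1 addn1 du.
exists (fun=> 0), (fun i' => if i' == i then 'X_[u] else 0).
rewrite big1 => [|G _]; last by rewrite mul0r.
rewrite add0r (bigD1 i) //= eqxx big1 ?addr0 // => i' /negPf->.
exact: mul0r.
Qed.

(** A p-th power which is divisible by [x_j] is the p-th power of a monomial
    divisible by [x_j]; hence the roots that occur are again multiples of
    [x^G]. *)
Lemma theta_nonface G g : G \notin D -> theta (g * xset k d G) = 0.
Proof.
move=> GD; rewrite mlin_mul big1 // => m _; rewrite xsetE -mpolyXD mlinX.
have [[u m_root du]|->] := root_weightP (m + mnm_ind G)%MM; last exact: mulr0.
rewrite m_root root_weight_muln du eqxx (@deg_nonface G) //.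
  by rewrite expr0n (negPf (lt0n_neq0 p_gt0)) mulr0.
apply/mnm_lepP => j; rewrite mnmE; have [jG|//] := boolP (j \in G).
have /mnmP/(_ j) := m_root; rewrite mnmDE mulmnE mnmE jG addn1.
by case: (u j).
Qed.

(** By Frobenius [mu_i ^+ p] only involves p-th powers of variables, so theta
    only sees the monomials of [g] which are p-th powers, say of [q]; it sends
    [q^p * mu_i^p] to the p-th power of [deg (q * mu_i)], which is 0. *)
Lemma theta_mu_exp i g : theta (g * mu k n i ^+ p) = 0.
Proof.
have pK := pchar_ratfun.
rewrite mlin_mul big1 // => m _.
rewrite /mu (pFrobenius_sum pK) ['X_[m] * _]mulr_sumr.
rewrite linear_sum /=; under eq_bigr => j _.
  rewrite -scalerAr linearZ /= mpolyXn -mpolyXD mlinX; over.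
have [[q ->]|[nq _]] := prootP K p_gt0 m; last first.
  rewrite big1 ?mulr0 // => j _.
  have [[u m_root _]|->] := root_weightP (m + U_(j) *+ p)%MM; last exact: mulr0.
  case: (nq (u - U_(j))%MM); apply/mnmP => l; rewrite mulmnE mnmBE mulnBl.
  by have /mnmP/(_ l) := m_root; rewrite mnmDE !mulmnE => <-; rewrite addnK.
have mulnD u v : ((u + v) *+ p = u *+ p + v *+ p)%MM.
  by apply/mnmP => l; rewrite mnmDE !mulmnE mnmDE mulnDl.
under eq_bigr => j _ do rewrite -mulnD root_weight_muln mdegD mdeg1 addn1.
have [dq|_] := eqVneq (mdeg q).+1 d; last first.
  by rewrite big1 ?mulr0 // => j _; rewrite mulr0.
have := pFrobenius_sum (A := K^o) pK (index_enum 'I_n) xpredT (a_ k i)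
  (fun j => deg 'X_[q + U_(j)]).
rewrite deg_mulX_mu // expr0n (negPf (lt0n_neq0 p_gt0)) => /esym ->.
exact: mulr0.
Qed.

Lemma theta_ideal f : artinian_ideal D f -> theta (f * mu_power) = 0.
Proof.
case=> g [h ->]; rewrite mulrDl linearD !mulr_suml !linear_sum /=.
rewrite !big1 ?addr0 // => [i _|G GD]; last by rewrite mulrAC theta_nonface.
rewrite /mu_power (bigD1 i) //= [_ ^+ _ * _]mulrC mulrACA -exprS prednK //.
exact: theta_mu_exp.
Qed.

(** A root of [x^F * m] is divisible by [x^F] and has degree [d = #|F|], so that
    it is [x^F]: a single monomial of [mu_power] contributes. *)
Lemma theta_facet (F : {set 'I_n}) : #|F| = d ->
  theta (xset k d F * mu_power) = bracket k d F ^+ p.-1 * deg (xset k d F) ^+ p.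
Proof.
move=> cardF; have dF : mdeg (mnm_ind F) = d by rewrite mdeg_ind.
have FE : (mnm_ind F + mnm_ind F *+ p.-1 = mnm_ind F *+ p)%MM.
  by rewrite -mulmS prednK.
rewrite xsetE (@mlin_mulX_single _ _ _ _ (mnm_ind F *+ p.-1)%MM) => [|m].
  by rewrite mcoeff_mu_power // FE root_weight_muln dF eqxx.
have [[u m_root du]|//] := root_weightP (mnm_ind F + m)%MM.
suff uF : u = mnm_ind F.
  by move: m_root; rewrite uF -FE => /addmI ->; rewrite eqxx.
have le_Fu : (mnm_ind F <= u)%MM.
  apply/mnm_lepP => j; rewrite mnmE; have [jF|//] := boolP (j \in F).
  by have /mnmP/(_ j) := m_root; rewrite mnmDE mulmnE mnmE jF; case: (u j).
have := congr1 mdeg (submK le_Fu); rewrite mdegD du dF => /eqP.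
rewrite -[X in _ == X]add0n eqn_add2r mdeg_eq0 => /eqP u0.
by rewrite -(submK le_Fu) u0 add0m.
Qed.

End DegreeFormula.

Theorem theorem1p1 (R : realType) (p : nat) (k : fieldType)
    (hp : p \in [pchar k]) (d n : nat) (D : {set {set 'I_n}})
    (hD : pseudomanifold R d D) (hconn : connected_complex R D)
    (eps : {set 'I_n} -> bool) (heps : orientation k D eps)
    (deg : {scalar {mpoly (ratfun k d n)[n]}}) (hdeg : degree_map D eps deg)
    (J : 'M[nat]_(1, n)) (hJ : (\sum_j J ord0 j)%N = d) :
  deg 'X_[mnm_of_mx J] =
    (-1) ^+ d * \sum_(I : 'M['I_p]_(d, n) | row_sums_pm1 I)
      deg (proot (ratfun k d n) p (mnm_of_mx (nat_mx I) + mnm_of_mx J)%MM) ^+ p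
        * (a_exp k (nat_mx I) / (mx_fact (nat_mx I))%:R).
Proof.
have p_gt0 := prime_gt0 (pcharf_prime hp).
have pK := pchar_ratfun d n hp.
have deg_ideal f : f \is d.-homog -> artinian_ideal D f -> deg f = 0.
  by move=> f_homog; apply: (degree_ker hdeg f_homog).2.
set M := mnm_of_mx J; set theta := mlin (root_weight p deg).
have dM : mdeg M = d.
  by rewrite mdegE -[RHS]hJ; apply: eq_bigr => j _; rewrite mnmE big_ord1.
transitivity (theta ('X_[M] * mu_power p k d n)).
  have [F facetF] : {F | F \in facets D}.
    have [F maxF _] := @maxset_exists _ [pred G in D] set0
      (complex_set0 (pm_complex hD)).
    by exists F; rewrite inE.
  have cardF : #|F| = d by apply: (pm_pure hD).
  have brF : bracket k d F != 0 by apply: bracket_neq0.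
  set x := xset k d F; have degx : deg x = (-1) ^+ eps F / bracket k d F.
    exact: (degree_facet hdeg).
  have degx0 : deg x != 0.
    by rewrite degx mulf_neq0 ?invr_eq0 // signr_eq0.
  have thetax : theta (x * mu_power p k d n) = deg x.
    have signX : ((-1) ^+ eps F) ^+ p = (-1) ^+ eps F :> ratfun k d n.
      rewrite exprAC -[in X in _ ^+ X ^+ _](prednK p_gt0) exprSr.
      by rewrite pchar_signX ?mul1r.
    rewrite [LHS](theta_facet hp) // -/x degx exprMn signX mulrCA.
    congr (_ * _); rewrite -{2}(prednK p_gt0) exprS mulrCA -exprMn.
    by rewrite divff // expr1n mulr1.
  (* In the one-dimensional H^d(D), x^J is c times the facet monomial x. *)
  pose c := deg 'X_[M] / deg x.
  have ker_f : artinian_ideal D ('X_[M] - c *: x).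
    apply/(degree_ker hdeg).
      rewrite rpredB ?rpredZ //; first by rewrite dhomogX; apply/eqP.
      by rewrite /x xsetE dhomogX /= mdeg_ind cardF.
    by rewrite linearB linearZ /= divfK // subrr.
  have := theta_ideal hp deg_ideal ker_f.
  rewrite mulrBl linearB -scalerAl linearZ /= -/theta thetax divfK //.
  by move/eqP; rewrite subr_eq0 => /eqP.
rewrite mu_power_expand // -scalerAr /theta linearZ /=; congr (_ * _).
rewrite mulr_sumr linear_sum; apply: eq_bigr => I /forallP rowI.
rewrite -scalerAr linearZ /= mulrC -mpolyXD mlinX /root_weight addmC.
have dpE : (d * p = d * p.-1 + d)%N by rewrite -{1}(prednK p_gt0) mulnS addnC.
rewrite mdegD dM dpE ifT // eqn_add2r mdegE.
under eq_bigr => j _ do rewrite mnmE.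
rewrite exchange_big /= -[X in (X * _)%N]card_ord -sum_nat_const.
apply/eqP/eq_bigr => i _; rewrite -(eqP (rowI i)).
by apply: eq_bigr => j _; rewrite mxE.
Qed.
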